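(* Let $A$ be a finite abelian group of order $n$. Then every path graph is $A$-cordial if and only if the path $P_n$ is $A$-cordial.
   Context: For a finite abelian group $A$ of order $n$ (written additively) and a graph $G$, a vertex labeling $\ell:V(G)\to A$ induces an edge labeling assigning to each edge $uv$ the label $\ell(u)+\ell(v)$. Let $\lambda^v=(\lambda^v_1\ge\dots\ge\lambda^v_n\ge 0)$ be the numbers of vertices carrying each element of $A$ (over all $n$ elements, in decreasing order, zeros allowed), and $\lambda^e$ the analogous sequence for edge labels. A sequence $\lambda$ is almost rectangular if $\lambda_i\in\{\lambda_1,\lambda_1-1,0\}$ for all $i$. The graph $G$ is $A$-cordial if some vertex labeling by $A$ makes both $\lambda^v$ and $\lambda^e$ almost rectangular. $P_j$ denotes the path graph with $j$ vertices. *)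

(* Defs.v *)
From mathcomp Require Import all_boot all_order all_algebra.

Set Implicit Arguments.
Unset Strict Implicit.
Unset Printing Implicit Defensive.

Import GRing.Theory.

(* Finite simple graphs. *)
Record sgraph := SGraph {
  vertex : finType;
  adj : rel vertex;
  adj_sym : symmetric adj;
  adj_irrefl : irreflexive adj }.

(* An unordered edge uv is the two-element vertex set [set u; v]. *)
Definition edges (G : sgraph) : {set {set vertex G}} :=
  [set [set u; v] | u in vertex G, v in vertex G & adj u v].

Definition path_adj (j : nat) : rel 'I_j :=
  fun u v => (u.+1 == v :> nat) || (v.+1 == u :> nat).

Lemma path_adj_sym j : symmetric (@path_adj j).
Proof. by move=> u v; rewrite /path_adj orbC. Qed.

Lemma path_adj_irrefl j : irreflexive (@path_adj j).
Proof. by move=> u; rewrite /path_adj orbb (gtn_eqF (ltnSn _)). Qed.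

Definition path_graph (j : nat) : sgraph :=
  SGraph (@path_adj_sym j) (@path_adj_irrefl j).

Section Labeling.

Variables (A : finZmodType) (G : sgraph) (l : vertex G -> A).

(* The sum over the endpoints of e; see edge_labelE. *)
Definition edge_label (e : {set vertex G}) : A := (\sum_(v in e) l v)%R.

Lemma edge_labelE (u v : vertex G) :
  adj u v -> edge_label [set u; v] = (l u + l v)%R.
Proof.
move=> uv; rewrite /edge_label big_setU1 ?big_set1 //= inE.
by apply/eqP => e; rewrite e adj_irrefl in uv.
Qed.

Definition vertex_counts : seq nat :=
  sort geq [seq #|[set v | l v == a]| | a : A].

Definition edge_counts : seq nat :=
  sort geq [seq #|[set e in edges G | edge_label e == a]| | a : A].

End Labeling.

(* For a decreasing sequence s, head 0 s is its first term.  The truncated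
   predecessor is harmless: if the first term is 0, all terms are 0. *)
Definition almost_rectangular (s : seq nat) : Prop :=
  forall k, k \in s -> [\/ k = head 0 s, k = (head 0 s).-1 | k = 0].

(* Hovey's balance condition: the label counts differ by at most one.  It is
   the previous condition without the value 0, which on its own would let
   constant labelings through. *)
Definition balanced (s : seq nat) : Prop :=
  forall k, k \in s -> k = head 0 s \/ k = (head 0 s).-1.

(* Cordiality with respect to the condition P on label counts. *)
Definition cordial_for (P : seq nat -> Prop) (A : finZmodType) (G : sgraph) :
    Prop :=
  exists l : vertex G -> A, P (vertex_counts l) /\ P (edge_counts l).

Definition cordial : finZmodType -> sgraph -> Prop :=
  cordial_for almost_rectangular.

Definition hovey_cordial : finZmodType -> sgraph -> Prop :=
  cordial_for balanced.

(* Main.v *)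
Require Import Defs.
From mathcomp Require Import all_boot all_order all_algebra.
From mathcomp Require Import zify.

(** With zero counts allowed, a constant labeling is always cordial, so only
    Hovey's condition has content.  A Hovey-cordial labeling of P_n lists A as
    a_0, ..., a_(n-1) with distinct sums of neighbours.  Let s be the sum of all
    elements of A; then 2s = 0.  Labeling vertex qn + i by a_i + qs keeps every
    block of n vertices a listing of A, and makes the edge labels n-periodic.
    The first n edge labels add up to 3s = s, while the first n - 1 of them are
    distinct; so the n-th one is exactly the missing element of A, and every
    block of n edge labels is a listing of A as well. *)

Set Implicit Arguments.
Unset Strict Implicit.
Unset Printing Implicit Defensive.

Import GRing.Theory.

(** * Sorted sequences of counts *)

Lemma sort_geq_head (s : seq nat) k :
  k \in sort geq s -> k <= head 0 (sort geq s) /\ head 0 (sort geq s) \in s.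
Proof.
rewrite -(mem_sort geq s).
have : sorted geq (sort geq s) by apply: sort_sorted => x y; exact: leq_total.
case: (sort geq s) => [//|h t] /= ht kht.
rewrite inE eqxx; split=> //; move: kht; rewrite inE => /predU1P[->//|kt].
have geq_trans : transitive geq by move=> y x z xy yz; exact: leq_trans yz xy.
by have /allP/(_ _ kt) := order_path_min geq_trans ht.
Qed.

Lemma sort_geq_almost_rectangular (T : finType) (c : T -> nat) m :
  (forall a, c a = m \/ c a = 0) ->
  almost_rectangular (sort geq [seq c a | a : T]).
Proof.
move=> cm k kc; have [kh /imageP[b _ hb]] := sort_geq_head kc.
move: kc; rewrite mem_sort => /imageP[a _ ka].
have ca := cm a; have cb := cm b.
(* Both [k] and the head lie in {0, m}, and [k] is at most the head, so a nonzero [k] equals it. *)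
have [k0|kh'] : k = 0 \/ k = head 0 (sort geq [seq c a | a : T]) by lia.
  by constructor 3.
by constructor 1.
Qed.

Lemma sort_geq_balanced (T : finType) (c : T -> nat) q :
  (forall a, q <= c a <= q.+1) -> balanced (sort geq [seq c a | a : T]).
Proof.
move=> cq k kc; have [kh /imageP[b _ hb]] := sort_geq_head kc.
move: kc; rewrite mem_sort => /imageP[a _ ka].
by have := cq a; have := cq b; lia.
Qed.

(** If the largest count were at least 2, balance would make every other count at least 1, and the
    total would exceed [#|T|]. *)
Lemma balanced_count_le1 (T : finType) (c : T -> nat) :
  balanced (sort geq [seq c a | a : T]) -> \sum_a c a <= #|T| ->
  forall a, c a <= 1.
Proof.
move=> cb sumc a; set s := [seq c a | a : T] in cb.
have cs x : c x \in sort geq s by rewrite mem_sort; apply: image_f.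
have [_ /imageP[b _ hb]] := sort_geq_head (cs a).
have ch x : c x <= c b by rewrite -hb; have [] := sort_geq_head (cs x).
have cl x : (c b).-1 <= c x by case: (cb _ (cs x)) => ->; lia.
rewrite (leq_trans (ch a)) // leqNgt; apply/negP => b2.
suff : #|T| < \sum_a c a by rewrite ltnNge sumc.
rewrite -sum1_card !(bigD1 b (P := predT)) //= -addSn.
rewrite leq_add //.
by apply: leq_sum => x _; have := cl x; lia.
Qed.

Lemma sum_count_mem (T : finType) (s : seq T) :
  \sum_a count_mem a s = size s.
Proof.
elim: s => [|x s IHs] /=; first by rewrite big1.
rewrite big_split /= IHs -big_mkcond /= (big_pred1 x) //.
Qed.

Lemma uniq_count_mem1 (T : finType) (s : seq T) :
  uniq s -> size s = #|T| -> forall a, count_mem a s = 1.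
Proof.
move=> us ss a; rewrite count_uniq_mem //.
by have [_ ->] := uniq_min_size us (fun x _ => mem_enum T x)
  (eq_leq (etrans (esym (cardT T)) (esym ss))); rewrite mem_enum.
Qed.

(** * Sequences that recur up to translation *)

Section Translates.

Variables (A : finZmodType) (n : nat) (g : nat -> A) (t : A).
Hypotheses (cardA : #|A| = n) (gD : forall k, g (n + k) = (g k + t)%R).
Hypothesis g_uniq : uniq [seq g k | k <- iota 0 n].

Lemma translate_block q m :
  [seq g k | k <- iota (q * n) m] = [seq (g k + t *+ q)%R | k <- iota 0 m].
Proof.
elim: q => [|q IHq] in m *.
  by apply: eq_map => k; rewrite mulr0n addr0.
rewrite mulSn iotaDl -map_comp.
transitivity [seq (x + t)%R | x <- [seq g k | k <- iota (q * n) m]].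
  by rewrite -map_comp; apply: eq_map => k; apply: gD.
rewrite IHq -map_comp; apply: eq_map => k /=.
by rewrite mulrSr addrA.
Qed.

Lemma translate_block_uniq q m : m <= n ->
  uniq [seq g k | k <- iota (q * n) m].
Proof.
move=> mn; rewrite translate_block.
rewrite (map_comp (fun x => x + t *+ q)%R g) map_inj_uniq; last exact: addIr.
by move: g_uniq; rewrite -(subnKC mn) iotaD map_cat cat_uniq => /andP[].
Qed.

(** The first [j] terms form [j %/ n] full blocks, each meeting [a] exactly once, followed by a
    truncated block without repetitions. *)
Lemma translate_count a j :
  j %/ n <= count_mem a [seq g k | k <- iota 0 j] <= (j %/ n).+1.
Proof.
have n_gt0 : 0 < n by rewrite -cardA (cardD1 0%R).
rewrite [in iota 0 j](divn_eq j n) iotaD map_cat count_cat add0n.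
have -> q : count_mem a [seq g k | k <- iota 0 (q * n)] = q.
  elim: q => [//|q IHq]; rewrite mulSn addnC iotaD map_cat count_cat IHq add0n.
  by rewrite uniq_count_mem1 ?addn1 ?translate_block_uniq ?size_map ?size_iota.
rewrite count_uniq_mem; last exact/translate_block_uniq/ltnW/ltn_pmod.
by case: (_ \in _); lia.
Qed.

End Translates.

(** * Label counts on paths *)

Lemma card_ord_count (T : eqType) j (h : nat -> T) a :
  #|[set i : 'I_j | h i == a]| = count_mem a [seq h k | k <- iota 0 j].
Proof.
rewrite cardsE cardE size_filter -enumT -val_enum_ord -map_comp.
rewrite [RHS]count_map; exact: eq_count.
Qed.

Section PathCounts.

Variables (A : finZmodType) (j : nat) (l : vertex (path_graph j) -> A).
Variable f : nat -> A.
Hypothesis lf : forall v : 'I_j, l v = f v.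

Lemma path_vertex_count a :
  #|[set v | l v == a]| = count_mem a [seq f k | k <- iota 0 j].
Proof.
by rewrite -card_ord_count; apply: eq_card => v; rewrite !inE lf.
Qed.

(** The edges of a nonempty path correspond bijectively to their left endpoints, through [ed] below.
    For [j = 0] both sides are zero. *)
Lemma path_edge_count a :
  #|[set e in edges (path_graph j) | edge_label l e == a]| =
  count_mem a [seq (f k + f k.+1)%R | k <- iota 0 j.-1].
Proof.
case: j l lf => [|m] l' lf' /=.
  by apply/eqP; rewrite cards_eq0; apply/eqP/setP => e; rewrite !inE;
    apply/andP => -[/imset2P[[]]].
pose ed (k : 'I_m) : {set 'I_m.+1} :=
  [set widen_ord (leqnSn m) k; lift ord0 k].
have ed_adj k : @adj (path_graph m.+1) (widen_ord (leqnSn m) k) (lift ord0 k).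
  by rewrite /= /path_adj lift0 eqxx.
have ed_inj : injective ed.
  move=> k k' kk'; apply: val_inj => /=.
  (* Both k and k + 1 lie in {k', k' + 1}, which forces k = k'. *)
  have : widen_ord (leqnSn m) k \in ed k' by rewrite -kk' !inE eqxx.
  have : lift ord0 k \in ed k' by rewrite -kk' !inE eqxx orbT.
  by rewrite !inE -!val_eqE /= /bump /=; lia.
have ed_label k : edge_label l' (ed k) = (f k + f k.+1)%R.
  by rewrite edge_labelE ?ed_adj // !lf' lift0.
have ed_edge (u v : 'I_m.+1) : u.+1 = v -> exists k, [set u; v] = ed k.
  move=> uv; have um : u < m by rewrite -ltnS uv.
  by exists (Ordinal um); congr [set _; _]; apply: val_inj; rewrite /= ?lift0.
have -> : [set e in edges (path_graph m.+1) | edge_label l' e == a] =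
    ed @: [set k : 'I_m | (f k + f k.+1)%R == a].
  apply/setP => e; rewrite inE; apply/andP/imsetP => [[/imset2P[u v _]]|[k]].
    rewrite inE => /andP[_ /orP[]/eqP uv] -> lab; have [k ek] := ed_edge _ _ uv.
      by exists k => //; rewrite inE -ed_label -ek.
    by exists k; rewrite ?inE -?ed_label -ek setUC.
  rewrite inE => /eqP fk ->; rewrite ed_label fk; split=> //.
  by apply/imset2P; exists (widen_ord (leqnSn m) k) (lift ord0 k);
    rewrite // inE ed_adj.
by rewrite card_imset // -card_ord_count.
Qed.

End PathCounts.

(** There are no more vertex labels, and no more edge labels, than elements of [A], so balance rules
    out repetitions. *)
Lemma path_balanced_uniq (A : finZmodType) n (l : vertex (path_graph n) -> A)
    (f : nat -> A) :
  #|A| = n -> (forall v : 'I_n, l v = f v) ->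
  balanced (vertex_counts l) -> balanced (edge_counts l) ->
  uniq [seq f k | k <- iota 0 n] /\
  uniq [seq (f k + f k.+1)%R | k <- iota 0 n.-1].
Proof.
move=> cardA lf; rewrite /vertex_counts /edge_counts.
rewrite [image _ _](eq_map (path_vertex_count lf)).
rewrite [image (fun a => #|[set e in _ | _]|) _](eq_map (path_edge_count lf)).
have count_uniq (s : seq A) : size s <= #|A| ->
    balanced (sort geq [seq count_mem a s | a : A]) -> uniq s.
  move=> sA bs; apply: count_mem_uniq => x; rewrite -has_pred1 has_count.
  have := balanced_count_le1 bs; rewrite sum_count_mem => /(_ sA x).
  by case: (count_mem x s) => [|[]].
by move=> bv be; split; apply: count_uniq; rewrite // size_map size_iota cardA
  ?leq_pred.
Qed.

(** * Sums over the group and the closing edge *)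

Lemma sum_finZmod_double (A : finZmodType) :
  (\sum_(a : A) a + \sum_(a : A) a = 0)%R.
(* Negation permutes [A], so the sum equals its own opposite. *)
Proof. by rewrite [X in (X + _)%R](reindex_inj oppr_inj) sumrN addNr. Qed.

Lemma uniq_sum_finZmod (A : finZmodType) (s : seq A) :
  uniq s -> size s = #|A| -> (\sum_(a <- s) a = \sum_(a : A) a)%R.
Proof.
move=> us ss; rewrite -big_enum; apply: perm_big.
apply/allP => x _ /=; rewrite (uniq_count_mem1 us ss).
by rewrite uniq_count_mem1 ?enum_uniq // -cardT.
Qed.

Lemma cyclic_edges_uniq (A : finZmodType) m (f : nat -> A) :
  #|A| = m.+1 -> uniq [seq f k | k <- iota 0 m.+1] ->
  uniq [seq (f k + f k.+1)%R | k <- iota 0 m] ->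
  f m.+1 = (f 0 + \sum_(a : A) a)%R ->
  uniq [seq (f k + f k.+1)%R | k <- iota 0 m.+1].
Proof.
move=> cardA fu eu fm; set s := (\sum_(a : A) a)%R in fm.
have s2 : (s + s = 0)%R := sum_finZmod_double A.
have sumf : (\sum_(0 <= k < m.+1) f k = s)%R.
  rewrite /s -(uniq_sum_finZmod fu) ?size_map ?size_iota // big_map.
  by rewrite /index_iota subn0.
(* The [m] edge labels cannot exhaust a group of order [m.+1]. *)
have [x xe] : exists x, x \notin [seq (f k + f k.+1)%R | k <- iota 0 m].
  apply/existsP; rewrite -negb_forall; apply/negP => /forallP allx.
  have := uniq_leq_size (enum_uniq A) (fun x _ => allx x).
  by rewrite -cardT cardA size_map size_iota ltnn.
have sume : (\sum_(0 <= k < m.+1) (f k + f k.+1) = s)%R.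
  rewrite big_split /= sumf.
  (* Shifting the index trades [f 0] for [f m.+1], which exceeds it by [s]. *)
  have -> : (\sum_(0 <= k < m.+1) f k.+1 = s + s)%R.
    rewrite big_nat_recr //= fm addrA; congr (_ + _)%R.
    by rewrite -sumf big_nat_recl // addrC.
  by rewrite s2 addr0.
have xu : uniq (x :: [seq (f k + f k.+1)%R | k <- iota 0 m]) by rewrite /= xe.
(* Adjoining [x] to the known edge labels lists all of [A]. *)
have sx : (x + \sum_(0 <= k < m) (f k + f k.+1) = s)%R.
  rewrite /s -(uniq_sum_finZmod xu) /= ?size_map ?size_iota //.
  by rewrite big_cons big_map /index_iota subn0.
rewrite -addn1 iotaD map_cat cats1 rcons_uniq add0n eu andbT.
suff <- : x = (f m + f m.+1)%R by [].
(* Cancelling the first [m] edge labels from the two expressions of [s] identifies [x]. *)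
by move: sume; rewrite big_nat_recr //= -sx addrC => /addIr.
Qed.

(** * Extending a labeling to all paths *)

Lemma hovey_cordial_path (A : finZmodType) :
  hovey_cordial A (path_graph #|A|) ->
  forall j, hovey_cordial A (path_graph j).
Proof.
case=> l [vb eb] j.
have [m cardA] : exists m, #|A| = m.+1.
  by exists #|A|.-1; rewrite prednK // (cardD1 0%R).
rewrite cardA in l vb eb; set s := (\sum_(a : A) a)%R.
(* The remainder is the position inside a block, so [inord] never takes its default value; the
   quotient counts the completed blocks. *)
pose f k := (l (inord (k %% m.+1) : 'I_m.+1) + s *+ (k %/ m.+1))%R.
have lf (v : 'I_m.+1) : l v = f v.
  by rewrite /f modn_small // divn_small // addr0 inord_val.
have [fu eu] := path_balanced_uniq cardA lf vb eb.
have fD k : f (m.+1 + k) = (f k + s)%R.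
  by rewrite /f modnDl divnDl // divnn /= add1n mulrSr addrA.
(* An edge label has two endpoints, so it shifts by s + s = 0: [translate_count] is used with shift
   [s] for vertices and 0 for edges. *)
have eD k : (f (m.+1 + k)%N + f (m.+1 + k).+1%N = (f k + f k.+1) + 0)%R.
  by rewrite -addnS !fD addrACA sum_finZmod_double.
have fm : f m.+1 = (f 0 + s)%R by rewrite -fD addn0.
have eu' := cyclic_edges_uniq cardA fu eu fm.
exists (fun v : 'I_j => f v); split; rewrite /vertex_counts /edge_counts.
  apply: (sort_geq_balanced (q := j %/ m.+1)) => a.
  by rewrite (@path_vertex_count _ _ _ f) // (translate_count cardA fD).
apply: (sort_geq_balanced (q := j.-1 %/ m.+1)) => a.
rewrite (@path_edge_count _ _ _ f) //.
exact: (@translate_count A m.+1 (fun k => f k + f k.+1)%R 0%R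
  cardA eD eu' a j.-1).
Qed.

Lemma constant_labeling_cordial (A : finZmodType) (G : sgraph) : cordial A G.
Proof.
exists (fun=> 0%R); split.
  apply: (sort_geq_almost_rectangular (m := #|vertex G|)) => a.
  have [a0|a0] := eqVneq 0%R a; [left|right].
    by apply: eq_card => v; rewrite inE.
  by apply: eq_card0 => v; rewrite inE.
apply: (sort_geq_almost_rectangular (m := #|edges G|)) => a.
have lab e : edge_label (fun _ : vertex G => 0%R : A) e = 0%R.
  exact: big1.
have [a0|a0] := eqVneq 0%R a; [left|right].
  by apply: eq_card => e; rewrite inE lab a0 eqxx andbT.
by apply: eq_card0 => e; rewrite inE lab (negbTE a0) andbF.
Qed.

Theorem theorem2p4 (A : finZmodType) (n : nat) (hn : #|A| = n) :
  ((forall j : nat, 0 < j -> cordial A (path_graph j)) <->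
    cordial A (path_graph n)) /\
  ((forall j : nat, 0 < j -> hovey_cordial A (path_graph j)) <->
    hovey_cordial A (path_graph n)).
Proof.
subst n; split; first by split=> *; apply: constant_labeling_cordial.
split=> [|/hovey_cordial_path Pj j _]; last exact: Pj.
(* [A] contains 0, so its order is positive and is an admissible [j]. *)
by apply; rewrite (cardD1 0%R).
Qed.
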